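(* Let $G$ be a finite directed graph and let $\mathcal H$ be the monoid of hikes on $G$. Every hike $h\in\mathcal H$, $h\neq 1$, can be written as a product $h=c_1c_2\cdots c_k$ of simple cycles of $G$, and this decomposition is unique up to permutations of consecutive vertex-disjoint simple cycles (that is, any two such decompositions of $h$ can be transformed into one another by finitely many exchanges of consecutive factors $c_i,c_{i+1}$ having no vertex in common). Equivalently, $\mathcal H$ is the trace monoid (free partially commutative monoid) whose alphabet is the set of simple cycles of $G$ and whose independence relation is $\{(c,c') : V(c)\cap V(c')=\emptyset\}$, where $V(c)$ is the set of vertices visited by $c$.
   Context: Let $G=(V,E)$ be a finite directed graph with $V=\{v_1,\dots,v_N\}$ and $E\subseteq V^2$ (loops allowed). Each arc $(v_i,v_j)\in E$ is identified with a letter $w_{ij}$. Let $\mathcal M$ be the trace monoid generated by the arcs, i.e. the quotient of the free monoid on the arcs by the relations $w_{ij}w_{kl}=w_{kl}w_{ij}$ for $i\neq k$ (arcs commute if and only if they start from different vertices). A hike is an element $w_{i_1j_1}\cdots w_{i_\ell j_\ell}$ of $\mathcal M$ such that for each $i=1,\dots,N$, $\#\{k: i_k=i\}=\#\{k: j_k=i\}$. The hikes form a submonoid $\mathcal H$ of $\mathcal M$, containing the empty hike $1$. A simple cycle is a hike of the form $w_{i_1i_2}w_{i_2i_3}\cdots w_{i_\ell i_1}$ with $\ell\ge 1$ and $i_1,\dots,i_\ell$ pairwise distinct (a loop if $\ell=1$, a backtrack if $\ell=2$); as an element of $\mathcal M$ it does not depend on the starting vertex. *)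

(* Defs.v *)
From HB Require Import structures.
From mathcomp Require Import all_boot boolp.
From Stdlib Require Import Relation_Operators.

Set Implicit Arguments.
Unset Strict Implicit.
Unset Printing Implicit Defensive.

Local Open Scope group_scope.
Local Open Scope quotient_scope.

Section Trace.
Variables (T : choiceType) (I : rel T).

Definition swap (u v : seq T) : Prop :=
  exists s a b t, [/\ I a b, u = s ++ a :: b :: t & v = s ++ b :: a :: t].

(* The monoid congruence on words generated by ab = ba for I a b: [swap] is
   already closed under left and right contexts. *)
Definition trace_cong : seq T -> seq T -> Prop := clos_refl_sym_trans _ swap.

(* generic_quotient wants a boolean equivalence; asbool provides one without a
   decision procedure. *)
Definition trace_eq : rel (seq T) := fun u v => `[< trace_cong u v >].

Fact trace_eqxx : reflexive trace_eq.
Proof. by move=> u; apply/asboolP; apply: rst_refl. Qed.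

Fact trace_eqC : symmetric trace_eq.
Proof. by move=> u v; apply/asboolP/asboolP; apply: rst_sym. Qed.

Fact trace_eq_trans : transitive trace_eq.
Proof.
move=> v u w /asboolP uv /asboolP vw.
by apply/asboolP; apply: rst_trans uv vw.
Qed.

Canonical trace_equiv := EquivRel trace_eq trace_eqxx trace_eqC trace_eq_trans.

Definition trace := {eq_quot trace_equiv}.

HB.instance Definition _ : EqQuotient _ trace_equiv trace := EqQuotient.on trace.
HB.instance Definition _ := Choice.on trace.

Lemma trace_piP (u v : seq T) : reflect (trace_cong u v) (u == v %[mod trace]).
Proof. by rewrite (eqmodE trace_equiv); apply: asboolP. Qed.

Lemma trace_cong_cat u1 u2 v1 v2 :
  trace_cong u1 v1 -> trace_cong u2 v2 -> trace_cong (u1 ++ u2) (v1 ++ v2).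
Proof.
move=> h1 h2; apply: (@rst_trans _ _ _ (v1 ++ u2)).
  elim: h1 => [x y [s [a [b [t [Iab -> ->]]]]]|x|x y _ ih|x y z _ ih1 _ ih2].
  - apply: rst_step; exists s, a, b, (t ++ u2).
    by rewrite -!catA.
  - exact: rst_refl.
  - exact: rst_sym.
  - exact: rst_trans ih1 ih2.
elim: h2 => [x y [s [a [b [t [Iab -> ->]]]]]|x|x y _ ih|x y z _ ih1 _ ih2].
- apply: rst_step; exists (v1 ++ s), a, b, t.
  by rewrite -!catA.
- exact: rst_refl.
- exact: rst_sym.
- exact: rst_trans ih1 ih2.
Qed.

Lemma trace_cong_perm u v : trace_cong u v -> perm_eq u v.
Proof.
elim=> [x y [s [a [b [t [_ -> ->]]]]]|x|x y _|x y z _ ih1 _ ih2].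
- rewrite perm_cat2l -[a :: b :: t]/([:: a] ++ [:: b] ++ t).
  by rewrite perm_catCA.
- exact: perm_refl.
- by rewrite perm_sym.
- exact: perm_trans ih1 ih2.
Qed.

Definition trace1 : trace := \pi_trace [::].
Definition trace_mul (x y : trace) : trace := \pi_trace (repr x ++ repr y).

Lemma trace_mulE u v :
  trace_mul (\pi_trace u) (\pi_trace v) = \pi_trace (u ++ v).
Proof.
by apply/eqP/trace_piP; apply: trace_cong_cat; apply/trace_piP; rewrite reprK.
Qed.

Fact trace_mulA : associative trace_mul.
Proof.
elim/quotW=> u; elim/quotW=> v; elim/quotW=> w.
by rewrite (trace_mulE v w) (trace_mulE u v) !trace_mulE catA.
Qed.

Fact trace_mul1g : left_id trace1 trace_mul.
Proof. by move=> x; rewrite -[x]reprK trace_mulE. Qed.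

Fact trace_mulg1 : right_id trace1 trace_mul.
Proof. by move=> x; rewrite -[x]reprK trace_mulE cats0. Qed.

HB.instance Definition _ :=
  isMonoid.Build trace trace_mulA trace_mul1g trace_mulg1.

Definition trace_gen (a : T) : trace := \pi_trace [:: a].

End Trace.

Section Hikes.
Variables (V : finType) (E : {set V * V}).

Definition arc_of := {a : V * V | a \in E}.
HB.instance Definition _ := Finite.on arc_of.

Definition source (a : arc_of) : V := (val a).1.
Definition target (a : arc_of) : V := (val a).2.

Definition arc_indep : rel arc_of := fun a b => source a != source b.

Definition arc_trace := trace arc_indep.
HB.instance Definition _ := monoid.Monoid.on arc_trace.
HB.instance Definition _ := EqQuotient.on arc_trace.

Definition balanced (w : seq arc_of) : bool :=
  [forall v, count (fun a => source a == v) w ==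
             count (fun a => target a == v) w].

(* Stated on the chosen representative; [is_hikeE] shows that any other one
   would do. *)
Definition is_hike : pred arc_trace := fun x => balanced (repr x).

Lemma is_hikeE (w : seq arc_of) : is_hike (\pi_arc_trace w) = balanced w.
Proof.
have /trace_cong_perm/permP cnt : trace_cong arc_indep
    (repr (\pi_arc_trace w)) w by apply/trace_piP; rewrite reprK.
by apply: eq_forallb => v; rewrite !cnt.
Qed.

Fact is_hike_umagma_closed : umagma_closed is_hike.
Proof.
split; first by rewrite -[_ \in _]/(is_hike (\pi_arc_trace [::])) is_hikeE;
  apply/forallP.
elim/quotW=> u; elim/quotW=> v.
have -> : \pi_arc_trace u * \pi_arc_trace v = \pi_arc_trace (u ++ v).
  exact: trace_mulE.
rewrite -[_ u \in _]/(is_hike _) -[_ v \in _]/(is_hike _).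
rewrite -[_ (u ++ v) \in _]/(is_hike _) !is_hikeE.
move=> /forallP hu /forallP hv; apply/forallP => i.
by rewrite !count_cat (eqP (hu i)) (eqP (hv i)).
Qed.

Definition hike := {x : arc_trace | is_hike x}.
HB.instance Definition _ := [isSub of hike for @sval _ _].
HB.instance Definition _ := [Choice of hike by <:].
HB.instance Definition _ :=
  SubChoice_isSubMonoid.Build arc_trace is_hike hike
    is_hike_umagma_closed.

(* w is w_{i_1 i_2} w_{i_2 i_3} ... w_{i_l i_1} for p = [:: i_1; ...; i_l]. *)
Definition closed_walk_along (p : seq V) (w : seq arc_of) : Prop :=
  [seq val a | a <- w] = zip p (rot 1 p).

Definition is_simple_cycle : pred hike := fun h =>
  `[< exists (p : seq V) (w : seq arc_of),
        [/\ p != [::], uniq p, closed_walk_along p w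
          & val h = \pi_arc_trace w] >].

Definition simple_cycle := {h : hike | is_simple_cycle h}.
HB.instance Definition _ := Choice.on simple_cycle.

(* The vertices incident to an arc of h, read on the chosen representative;
   [visitedE] shows that any other one would do. *)
Definition visited (h : hike) : {set V} :=
  [set v | has (fun a => (source a == v) || (target a == v)) (repr (val h))].

Lemma visitedE (h : hike) (w : seq arc_of) : val h = \pi_arc_trace w ->
  visited h = [set v | has (fun a => (source a == v) || (target a == v)) w].
Proof.
move=> hw; have /trace_cong_perm/perm_has ph : trace_cong arc_indep
    (repr (val h)) w by apply/trace_piP; rewrite reprK hw.
by apply/setP => v; rewrite !inE ph.
Qed.

Definition vertex_disjoint : rel simple_cycle :=
  fun c d => [disjoint visited (val c) & visited (val d)].

End Hikes.

(* Main.v *)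
Require Import Defs.
From mathcomp Require Import all_boot boolp.
From Stdlib Require Import Relation_Operators.

(** Arcs commute unless they leave the same vertex, so a trace amounts to one
    stack of arcs per vertex, and traces are multiplied stack by stack.

    Existence: start at a vertex with a nonempty stack and keep following the
    arc on top of the stack of the current vertex.  Balance guarantees that the
    target of an arc also has a nonempty stack, so this walk ends up in a cycle;
    its arcs all lie on top of their stacks, hence it is a left factor.

    Uniqueness: if [c] is a left factor of a product of simple cycles, let [d]
    be the first factor meeting [c].  The earlier factors leave the stacks of
    [c] untouched, so [c] and [d] have the same arc at every common vertex, thus
    [c = d], and [c] can be exchanged to the front and cancelled. *)

Local Open Scope group_scope.
Local Open Scope quotient_scope.

(** * Closures of relations, functional cycles and cyclic sequences *)

(** Links the congruence defining [trace], closed under symmetry, to the one-way chains of exchanges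
    in the theorem: a symmetric step can simply be reversed. *)
Lemma clos_rst_rt (A : Type) (R : A -> A -> Prop) :
  (forall x y, R x y -> R y x) ->
  forall x y, clos_refl_sym_trans A R x y -> clos_refl_trans A R x y.
Proof.
move=> symR x y; elim=> {x y} [x y|x|x y _|x y z _ xy _ yz].
- exact: rt_step.
- exact: rt_refl.
- elim=> [{}x {}y /symR|{}x|{}x {}y z _ yx _ zy]; first exact: rt_step.
    exact: rt_refl.
  exact: rt_trans zy yx.
- exact: rt_trans xy yz.
Qed.

Lemma exists_fcycle (T : finType) (f : T -> T) (x : T) :
  exists p, [/\ p != [::], uniq p, fcycle f p & {subset p <= fconnect f x}].
Proof.
(* The iterates of [x] come back to an earlier one, the [i]-th; from there on the orbit is closed,
   as [order f x - i] further steps return to [y]. *)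
have /trajectP[i ltin eq_i] := looping_order f x.
pose y := iter i f x; exists (orbit f y).
have fyy : y \in fconnect f (f y).
  have := fconnect_iter f (order f x - i.+1) (f y).
  by rewrite -iterSr -iterD addSnnS subnK // eq_i.
split.
- by rewrite -size_eq0 size_orbit -lt0n order_gt0.
- exact: orbit_uniq.
- exact/(orbitPcycle 0 2).
- move=> z; rewrite -fconnect_orbit; apply: connect_trans.
  exact: fconnect_iter.
Qed.

Lemma map_next (T : eqType) (p : seq T) : uniq p -> map (next p) p = rot 1 p.
Proof.
case: p => [//|x p] up; rewrite rot1_cons.
apply: (@eq_from_nth _ x) => [|i].
  by rewrite size_map size_rcons.
rewrite size_map => ltip.
rewrite (nth_map x) // next_nth mem_nth // index_uniq //.
by rewrite nth_rcons_default.
Qed.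

Lemma filter_pred1 (T : eqType) (p : seq T) (x : T) :
  uniq p -> [seq y <- p | y == x] = if x \in p then [:: x] else [::].
Proof.
move=> up; case: ifP => [|/negP/negP xp]; first exact: filter_pred1_uniq.
by apply/eqP; rewrite -[_ == _]negbK -has_filter has_pred1.
Qed.

(** Reads a closed walk as the graph of the successor function [next p], so that its arcs are
    indexed by their sources. *)
Lemma zip_rot1 (T : eqType) (p : seq T) :
  uniq p -> zip p (rot 1 p) = [seq (x, next p x) | x <- p].
Proof. by move=> up; rewrite -map_next // -{1}[p]map_id zip_map. Qed.

Section HikeFactorization.
Set Implicit Arguments.
Unset Strict Implicit.
Variables (V : finType) (E : {set V * V}).

Local Notation arc := (arc_of E).
Local Notation trace_cong := (trace_cong (@arc_indep V E)).

(** * Traces as families of stacks *)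

Definition out_arcs (v : V) (w : seq arc) := [seq a <- w | source a == v].

Lemma out_arcs_cat v u w : out_arcs v (u ++ w) = out_arcs v u ++ out_arcs v w.
Proof. exact: filter_cat. Qed.

Lemma trace_cong_cons (a : arc) u w :
  trace_cong u w -> trace_cong (a :: u) (a :: w).
Proof. by apply: (@trace_cong_cat _ _ [:: a] u [:: a] w); apply: rst_refl. Qed.

Lemma trace_cong_move_front (a : arc) u w :
  out_arcs (source a) u = [::] -> trace_cong (u ++ a :: w) (a :: u ++ w).
Proof.
elim: u => [|b u ih] /=; first by move=> _; apply: rst_refl.
case: eqP => // /eqP ba /ih {}ih.
apply: rst_trans (trace_cong_cons b ih) _.
by apply: rst_step; exists [::], b, a, (u ++ w).
Qed.

Lemma out_arcs_eq_cons (a : arc) w s : out_arcs (source a) w = a :: s ->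
  exists w1 w2, w = w1 ++ a :: w2 /\ out_arcs (source a) w1 = [::].
Proof.
elim: w => [//|b w ih] /=.
case: eqP => [_ [-> _]|/eqP/negPf ba /ih[w1 [w2 [-> w1a]]]].
  by exists [::], w.
by exists (b :: w1), w2; rewrite /= ba.
Qed.

(** An exchange involves arcs of distinct sources, so it alters no stack. Conversely, the first arc
    of [u] tops its stack in [w], hence only arcs of other sources precede it there; it moves to the
    front and induction applies to what remains. *)
Lemma trace_cong_out_arcs u w :
  trace_cong u w <-> forall v, out_arcs v u = out_arcs v w.
Proof.
split=> [+ v|].
  elim=> [x y [s [a [b [t [ab -> ->]]]]]|x|x y _ ->|x y z _ -> _ ->] //.
  rewrite !out_arcs_cat /=; case: eqP => [av|//]; case: eqP => [bv|//].
  by move: ab; rewrite /arc_indep av bv eqxx.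
elim: u w => [|a u ih] w eq_uw.
  case: w eq_uw => [_|a w /(_ (source a))]; first exact: rst_refl.
  by rewrite /= eqxx.
have := eq_uw (source a); rewrite /= eqxx => /esym/out_arcs_eq_cons.
move=> [w1 [w2 [def_w w1a]]]; rewrite def_w in eq_uw *.
apply: rst_trans (rst_sym _ _ _ _ (trace_cong_move_front w2 w1a)).
apply/trace_cong_cons/ih => v; move: (eq_uw v).
rewrite !out_arcs_cat /=; case: eqP => [<-|//].
by rewrite w1a => -[].
Qed.

(** The stack of [h] at [v], top first. *)
Definition hike_arcs (h : hike E) (v : V) : seq arc :=
  out_arcs v (repr (val h)).

Lemma hike_arcs_pi (h : hike E) w v :
  val h = \pi_(arc_trace E) w -> hike_arcs h v = out_arcs v w.
Proof.
move=> hw; move: v; apply/trace_cong_out_arcs/trace_piP.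
by rewrite reprK hw.
Qed.

Lemma hike_arcs_inj (h k : hike E) : hike_arcs h =1 hike_arcs k -> h = k.
Proof.
move=> /trace_cong_out_arcs/trace_piP/eqP; rewrite !reprK; exact: val_inj.
Qed.

Lemma hike_arcs1 v : hike_arcs 1 v = [::].
Proof. exact: (@hike_arcs_pi 1 [::]). Qed.

Lemma hike_arcsM (h k : hike E) v :
  hike_arcs (h * k) v = hike_arcs h v ++ hike_arcs k v.
Proof. by rewrite -out_arcs_cat; apply: hike_arcs_pi. Qed.

(** Serves to build a word with prescribed stacks: concatenate them in any order of the vertices. *)
Lemma out_arcs_bigcat (s : V -> seq arc) r v :
    uniq r -> (forall u, all (fun a => source a == u) (s u)) ->
  out_arcs v (\big[cat/[::]]_(u <- r) s u) = if v \in r then s v else [::].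
Proof.
move=> ur src_s; rewrite (big_morph (out_arcs v) (@out_arcs_cat v) (erefl _)).
rewrite (eq_bigr (fun u => if u == v then s u else [::])) => [|u _].
  rewrite -big_mkcond -big_filter filter_pred1 //.
  by case: ifP; rewrite ?big_seq1 ?big_nil.
case: eqP => [<-|/eqP uv]; first exact/all_filterP.
apply/eqP; rewrite -[_ == _]negbK -has_filter -all_predC.
by apply: sub_all (src_s u) => a /= /eqP ->.
Qed.

(** * Simple cycles and balance; splitting a cycle off a hike *)

Lemma hike_of_word w : balanced w ->
  exists h : hike E, val h = \pi_(arc_trace E) w.
Proof. by rewrite -is_hikeE => hw; exists (exist (@is_hike V E) _ hw). Qed.

Lemma simple_cycleP (h : hike E) :
  is_simple_cycle h -> exists p, [/\ p != [::], uniq p,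
      visited h =i p &
      forall v, [seq val a | a <- hike_arcs h v] =
                if v \in p then [:: (v, next p v)] else [::]].
Proof.
move=> /asboolP[p [w [p0 up pw hw]]]; exists p; split=> // v.
  rewrite (visitedE hw) inE.
  rewrite -[has _ _](has_map val (fun e : V * V => (e.1 == v) || (e.2 == v))).
  rewrite pw zip_rot1 // has_map.
  apply/hasP/idP => [[u up' /= /orP[]/eqP<-]|vp] //.
    by rewrite mem_next.
  by exists v; rewrite //= eqxx.
rewrite (hike_arcs_pi _ hw) -(filter_map val (fun e : V * V => e.1 == v)).
rewrite pw zip_rot1 // filter_map.
by rewrite (@eq_filter _ _ (pred1 v)) // filter_pred1 //; case: ifP.
Qed.

Lemma closed_walk_balanced p (w : seq arc) :
  closed_walk_along p w -> balanced w.
Proof.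
move=> pw; apply/forallP => v.
rewrite -[count _ _](count_map val (fun e : V * V => e.1 == v)).
rewrite -[X in _ == X](count_map val (fun e : V * V => e.2 == v)).
rewrite pw -(count_map fst (pred1 v)) -(count_map snd (pred1 v)).
(* The sources list [p] and the targets list a rotation of [p]. *)
rewrite -/unzip1 -/unzip2 unzip1_zip ?unzip2_zip ?size_rot //.
by apply/eqP/permP; rewrite perm_sym perm_rot.
Qed.

Lemma balanced_cat_l (u w : seq arc) :
  balanced u -> balanced (u ++ w) -> balanced w.
Proof.
move=> /forallP bu /forallP buw; apply/forallP => v; have := buw v.
by rewrite !count_cat (eqP (bu v)) eqn_add2l.
Qed.

Lemma trace_cong_balanced (u w : seq arc) :
  trace_cong u w -> balanced u = balanced w.
Proof.
by move=> /trace_cong_perm/permP uw; apply: eq_forallb => v; rewrite !uw.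
Qed.

Lemma hike_arcs_target (h : hike E) v a :
  a \in hike_arcs h v -> hike_arcs h (target a) != [::].
Proof.
rewrite mem_filter => /andP[_ ah].
rewrite -size_eq0 size_filter (eqP (forallP (valP h) _)) -lt0n -has_count.
by apply/hasP; exists a.
Qed.

Lemma exists_hike_arcs_neq0 (h : hike E) : h <> 1 -> exists v, hike_arcs h v != [::].
Proof.
move=> h1; case: (pickP (fun v => hike_arcs h v != [::])) => [v hv|h0].
  by exists v.
by case: h1; apply: hike_arcs_inj => v; rewrite hike_arcs1; apply/eqP/negbFE/h0.
Qed.

Lemma cycle_factor (h : hike E) : h <> 1 ->
  exists (c : simple_cycle E) (k : hike E), h = val c * k.
Proof.
move=> h1.
(* The default [v] is never met: the walk starts at a nonempty stack and, by [S_nx], stays on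
   nonempty stacks. *)
pose nx v := if hike_arcs h v is a :: _ then target a else v.
have S_nx v : hike_arcs h v != [::] -> hike_arcs h (nx v) != [::].
  rewrite /nx; case hv: (hike_arcs h v) => [//|a s] _.
  by apply: (@hike_arcs_target _ v); rewrite hv mem_head.
have [x Sx] := exists_hike_arcs_neq0 h1.
have [p [p0 up cp pS]] := @exists_fcycle _ nx x.
have Sp v : v \in p -> hike_arcs h v != [::].
  move=> /pS; rewrite -topredE /= fconnect_orbit => /trajectP[i _ ->].
  by elim: i => [//|i]; apply: S_nx.
pose top v := take 1 (hike_arcs h v).
have topE v : v \in p -> map val (top v) = [:: (v, next p v)].
  move=> vp; have := next_cycle cp vp; rewrite /= => /eqP <-.
  move: (Sp v vp); rewrite /top /nx; case hv: (hike_arcs h v) => [//|a s] _.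
  have : a \in hike_arcs h v by rewrite hv mem_head.
  rewrite mem_filter /= take0 => /andP[/eqP <- _].
  by rewrite [val a]surjective_pairing.
pose cw := \big[cat/[::]]_(v <- p) top v.
(* The cofactor keeps every stack, minus its top at the vertices of the cycle. *)
pose rest := \big[cat/[::]]_v
  (if v \in p then behead (hike_arcs h v) else hike_arcs h v).
have cwE : closed_walk_along p cw.
  rewrite /closed_walk_along zip_rot1 // /cw.
  rewrite (big_morph (map val) (@map_cat _ _ val) (erefl _)).
  rewrite big_seq (eq_bigr (fun v => [:: (v, next p v)])) // -big_seq.
  (* The successor function is generalized to [g], since it must not change while the list
     shrinks. *)
  by elim: (p) (next p) => [|y q ih] g; rewrite ?big_nil ?big_cons //= ih.
have src v : all (fun a => source a == v) (hike_arcs h v) by apply: filter_all.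
have h_split : trace_cong (repr (val h)) (cw ++ rest).
  have src_top u : all (fun a => source a == u) (top u) /\
      all (fun a => source a == u) (behead (hike_arcs h u)).
    apply/andP; rewrite -all_cat -drop1 cat_take_drop; exact: src.
  apply/trace_cong_out_arcs => v; rewrite out_arcs_cat.
  rewrite !out_arcs_bigcat ?index_enum_uniq //.
  - rewrite mem_index_enum -/(hike_arcs h v); case: ifP => // _.
    by rewrite -drop1 cat_take_drop.
  - by move=> u; case: ifP => _; [case: (src_top u) | apply: src].
  - by move=> u; case: (src_top u).
have bcw := closed_walk_balanced cwE.
have brest : balanced rest.
  apply: balanced_cat_l bcw _.
  by rewrite -(trace_cong_balanced h_split); apply: (valP h).
have [c hc] := hike_of_word bcw; have [k hk] := hike_of_word brest.
have sc : is_simple_cycle c by apply/asboolP; exists p, cw.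
exists (exist (@is_simple_cycle V E) c sc), k; apply: hike_arcs_inj => v.
rewrite hike_arcsM (hike_arcs_pi _ hc) (hike_arcs_pi _ hk) -out_arcs_cat.
by move: v; apply/trace_cong_out_arcs.
Qed.

(** * Products of simple cycles and uniqueness *)

Local Notation disj := (@vertex_disjoint V E).
Implicit Types (c d : simple_cycle E) (cs ds : seq (simple_cycle E)).

Lemma cycle_arcs_nil c v :
  v \notin visited (val c) -> hike_arcs (val c) v = [::].
Proof.
have [p [_ _ pc arcs_p]] := simple_cycleP (valP c).
rewrite pc => /negPf vp.
by apply/nilP; rewrite /nilp -(size_map val) arcs_p vp.
Qed.

Lemma exists_visited c : exists v, v \in visited (val c).
Proof.
have [[|v p] [p0 _ pc _]] := simple_cycleP (valP c); first by [].
by exists v; rewrite pc mem_head.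
Qed.

Lemma cycle_arcs_neq0 c v :
  v \in visited (val c) -> hike_arcs (val c) v != [::].
Proof.
have [p [_ _ pc arcs_p]] := simple_cycleP (valP c).
by rewrite pc -size_eq0 -(size_map val) arcs_p => ->.
Qed.

Lemma vertex_disjointC c d : disj c d = disj d c.
Proof. exact: disjoint_sym. Qed.

Lemma vertex_disjoint_commute c d : disj c d -> val c * val d = val d * val c.
Proof.
move=> cd; apply: hike_arcs_inj => v; rewrite !hike_arcsM.
have [vc|vc] := boolP (v \in visited (val c)).
  by rewrite (@cycle_arcs_nil d) ?cats0 // (disjointFr cd).
by rewrite (@cycle_arcs_nil c) ?cats0.
Qed.

(** A simple cycle has one arc at each visited vertex, so equal tops mean equal successors; from [x]
    on, both walks run through the same vertices. *)
Lemma cycle_eq c d x : x \in visited (val c) -> x \in visited (val d) ->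
  (forall v, v \in visited (val c) -> v \in visited (val d) ->
     ohead (hike_arcs (val c) v) = ohead (hike_arcs (val d) v)) ->
  c = d.
Proof.
have [p [_ up pc arcs_p]] := simple_cycleP (valP c).
have [q [_ uq qd arcs_q]] := simple_cycleP (valP d).
rewrite pc qd => xp xq heads.
have next_pq v : v \in p -> v \in q -> next p v = next q v.
  move=> vp vq; have := heads v; rewrite pc qd => /(_ vp vq).
  have := arcs_p v; have := arcs_q v; rewrite vp vq.
  case: hike_arcs => [//|a s] [va _]; case: hike_arcs => [//|b t] [vb _] [ab].
  by move: vb; rewrite ab va => -[].
have iter_pq i : [/\ iter i (next p) x \in p, iter i (next p) x \in q
                  & iter i (next p) x = iter i (next q) x].
  elim: i => [//|i [ip iq eq_i]]; rewrite !iterS -eq_i.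
  by rewrite mem_next next_pq // mem_next.
have eq_pq v : (v \in p) = (v \in q).
  apply/idP/idP.
    rewrite -(fconnect_cycle (cycle_next up) xp) fconnect_orbit.
    move=> /trajectP[i _ ->].
    by have [] := iter_pq i.
  rewrite -(fconnect_cycle (cycle_next uq) xq) fconnect_orbit.
  move=> /trajectP[i _ ->].
  by have [ip _ <-] := iter_pq i.
apply/val_inj/hike_arcs_inj => v; apply: (inj_map val_inj).
by rewrite arcs_p arcs_q -eq_pq; case: ifP => // vp; rewrite next_pq // -eq_pq.
Qed.

Definition cycle_prod cs : hike E := \prod_(c <- cs) val c.

Lemma cycle_prod_nil : cycle_prod [::] = 1.
Proof. exact: big_nil. Qed.

Lemma cycle_prod_cons c cs : cycle_prod (c :: cs) = val c * cycle_prod cs.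
Proof. exact: big_cons. Qed.

Lemma cycle_prod_cat cs ds :
  cycle_prod (cs ++ ds) = cycle_prod cs * cycle_prod ds.
Proof. exact: big_cat. Qed.

(** Left divisibility by [c] is assumed stack by stack, a form that passes to the tail of [ds]
    without exhibiting a cofactor. *)
Lemma cycle_prod_factor c ds :
    (forall v, exists t,
       hike_arcs (cycle_prod ds) v = hike_arcs (val c) v ++ t) ->
  exists ds1 ds2, ds = ds1 ++ c :: ds2 /\ all (disj c) ds1.
Proof.
elim: ds => [|d ds ih] pre_c.
  have [v /cycle_arcs_neq0] := exists_visited c; have [t] := pre_c v.
  by rewrite cycle_prod_nil hike_arcs1; case: hike_arcs.
have [cd|] := boolP (disj c d).
  have [|ds1 [ds2 [-> cds1]]] := ih.
    move=> v; have [vc|vc] := boolP (v \in visited (val c)); last first.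
      by rewrite cycle_arcs_nil //; eexists.
    have [t] := pre_c v; rewrite cycle_prod_cons hike_arcsM.
    rewrite (@cycle_arcs_nil d); first by exists t.
    by rewrite (disjointFr cd).
  by exists (d :: ds1), ds2; rewrite /= cd.
rewrite /vertex_disjoint disjoint_subset => /subsetPn[x xc].
rewrite inE negbK => xd; exists [::], ds; split=> //=; congr (_ :: _).
apply: esym; apply: (cycle_eq xc xd) => v vc vd; have [t] := pre_c v.
rewrite cycle_prod_cons hike_arcsM.
move: (cycle_arcs_neq0 vc); case: (hike_arcs (val c) v) => [//|a s] _.
by move: (cycle_arcs_neq0 vd); case: (hike_arcs (val d) v) => [//|b u] _ [->].
Qed.

Local Notation swaps := (clos_refl_trans _ (swap disj)).

Lemma swaps_cons c cs ds : swaps cs ds -> swaps (c :: cs) (c :: ds).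
Proof.
elim=> {cs ds} [cs ds [s [a [b [t [ab -> ->]]]]]|cs|cs ds es _ h1 _ h2].
- by apply: rt_step; exists (c :: s), a, b, t.
- exact: rt_refl.
- exact: rt_trans h1 h2.
Qed.

Lemma swaps_move_front c cs ds :
  all (disj c) cs -> swaps (c :: cs ++ ds) (cs ++ c :: ds).
Proof.
elim: cs => [_|d cs ih /= /andP[cd /ih/swaps_cons h]]; first exact: rt_refl.
by apply: rt_trans (h d); apply: rt_step; exists [::], c, d, (cs ++ ds).
Qed.

Lemma swaps_prod cs ds : swaps cs ds -> cycle_prod cs = cycle_prod ds.
Proof.
elim=> {cs ds} [cs ds [s [a [b [t [ab -> ->]]]]]|cs|cs1 cs2 cs3 _ h1 _ h2].
- rewrite !cycle_prod_cat !cycle_prod_cons.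
  by rewrite [val a * _]mulgA (vertex_disjoint_commute ab) -mulgA.
- by [].
- exact: etrans h1 h2.
Qed.

Lemma cycle_prod_unique cs ds : cycle_prod cs = cycle_prod ds -> swaps cs ds.
Proof.
elim: cs ds => [|c cs ih] ds eq_cd.
  case: ds eq_cd => [_|d ds]; first exact: rt_refl.
  rewrite cycle_prod_nil cycle_prod_cons => eq_d.
  have [v /cycle_arcs_neq0] := exists_visited d.
  have := congr1 (hike_arcs ^~ v) eq_d.
  by rewrite hike_arcs1 hike_arcsM; case: hike_arcs.
have [|ds1 [ds2 [def_ds cds1]]] := @cycle_prod_factor c ds.
  by move=> v; rewrite -eq_cd cycle_prod_cons hike_arcsM; eexists.
rewrite def_ds in eq_cd *.
apply: rt_trans (swaps_move_front _ cds1); apply/swaps_cons/ih.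
move: eq_cd; rewrite -(swaps_prod (swaps_move_front _ cds1)) !cycle_prod_cons => eq_cd.
(* Left cancellation: in each stack the two sides share the prefix coming from [c]. *)
apply: hike_arcs_inj => v; have := congr1 (hike_arcs ^~ v) eq_cd.
by rewrite !hike_arcsM => /eqP; rewrite eqseq_cat // => /andP[_ /eqP].
Qed.

(** * Existence of factorizations and the isomorphism with the trace monoid *)

Lemma cycle_prod_exists (h : hike E) : exists cs, h = cycle_prod cs.
Proof.
have [n] := ubnP (size (repr (val h))).
elim: n h => // n ih h; rewrite ltnS => le_h_n.
have [->|/eqP/cycle_factor[c [k def_h]]] := eqVneq h 1.
  by exists [::]; rewrite cycle_prod_nil.
have [|cs def_k] := ih k; last first.
  by exists (c :: cs); rewrite cycle_prod_cons def_h def_k.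
(* The cofactor [k] has fewer arcs than [h]: congruent words have equal length, and [c] has at least
   one arc. *)
apply: leq_trans le_h_n.
have /trace_cong_perm/perm_size -> :
    trace_cong (repr (val h)) (repr (val (val c)) ++ repr (val k)).
  by apply/trace_piP; rewrite reprK def_h.
rewrite size_cat -[ltnLHS]add0n ltn_add2r.
have [v /cycle_arcs_neq0] := exists_visited c.
by rewrite /hike_arcs; case: repr.
Qed.

Definition cycle_eval (x : trace disj) : hike E := cycle_prod (repr x).

Lemma trace_cong_swaps cs ds : Defs.trace_cong disj cs ds <-> swaps cs ds.
Proof.
split.
  apply: clos_rst_rt => {cs ds} cs ds [s [a [b [t [ab -> ->]]]]].
  by exists s, b, a, t; rewrite vertex_disjointC.
elim=> [x y|x|x y z _ xy _ yz]; first exact: rst_step.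
  exact: rst_refl.
exact: rst_trans xy yz.
Qed.

Lemma cycle_eval_pi cs : cycle_eval (\pi cs) = cycle_prod cs.
Proof. by apply/swaps_prod/trace_cong_swaps/trace_piP; rewrite reprK. Qed.

End HikeFactorization.

Theorem mainTheorem1 (V : finType) (E : {set V * V}) :
  (forall h : hike E, h <> 1 ->
     (exists cs : seq (simple_cycle E), h = \prod_(c <- cs) val c) /\
     (forall cs ds : seq (simple_cycle E),
        h = \prod_(c <- cs) val c -> h = \prod_(d <- ds) val d ->
        clos_refl_trans _ (swap (@vertex_disjoint V E)) cs ds)) /\
  (exists f : trace (@vertex_disjoint V E) -> hike E,
     [/\ monoid_morphism f, bijective f &
         forall c : simple_cycle E, f (trace_gen _ c) = val c]).
Proof.
split=> [h _|].
  split; first exact: cycle_prod_exists.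
  by move=> cs ds hc hd; apply: cycle_prod_unique; rewrite /cycle_prod -hc -hd.
exists (@cycle_eval V E); split.
- split; first by rewrite cycle_eval_pi cycle_prod_nil.
  elim/quotW=> cs; elim/quotW=> ds.
  by rewrite [_ * _]trace_mulE !cycle_eval_pi cycle_prod_cat.
- have surj (h : hike E) : exists x, cycle_eval x == h.
    have [cs ->] := cycle_prod_exists h; exists (\pi cs).
    by rewrite cycle_eval_pi.
  (* The inverse chooses a factorization; uniqueness up to exchanges makes its class the original
     trace. *)
  exists (fun h => xchoose (surj h)) => [x|h]; last exact/eqP/(xchooseP (surj h)).
  have := eqP (xchooseP (surj (cycle_eval x))).
  move: (xchoose _) => y; elim/quotW: x; elim/quotW: y => cs ds.
  by rewrite !cycle_eval_pi => /cycle_prod_unique/trace_cong_swaps/trace_piP/eqP.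
- by move=> c; rewrite cycle_eval_pi /cycle_prod big_seq1.
Qed.
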